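(* Let $K\subset\mathbb{R}^m$ be an unconditional convex body, let $v\in\mathbb{S}^{m-1}$, and let $E:=\mathrm{span}(v)$ be the corresponding $1$-dimensional subspace. Then $$|P_E(K\cap\mathbb{R}^m_+)|_1\le|P_EK|_1\le2\,|P_E(K\cap\mathbb{R}^m_+)|_1 .$$ Moreover, if $v_+:=\sum_{v_i>0}v_ie_i$ and $v_-:=\sum_{v_i<0}v_ie_i$, then equality holds on the right if and only if either $v\in\mathbb{R}^m_+\cup(-\mathbb{R}^m_+)$, or $v\notin\mathbb{R}^m_+\cup(-\mathbb{R}^m_+)$ and the faces $F(K;v_+)$ and $F(K;v_-)$ intersect. In the case where $K$ is the ball $B_q^m$ with $1\le q<\infty$, equality holds on the right if and only if $v\in\mathbb{R}^m_+\cup(-\mathbb{R}^m_+)$. The left inequality is sharp: for every $m\ge2$, there are an unconditional convex body $K\subset\mathbb{R}^m$ and a vector $v\in\mathbb{S}^{m-1}$ such that, with $E=\mathrm{span}(v)$, one has $|P_E(K\cap\mathbb{R}^m_+)|_1=|P_EK|_1$.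
   Context: A convex body is a compact convex set with nonempty interior. $K\subset\mathbb{R}^m$ is unconditional if $(\varepsilon_1x_1,\dots,\varepsilon_mx_m)\in K$ for every $x\in K$ and every $\varepsilon\in\{-1,1\}^m$. $e_1,\dots,e_m$ is the canonical basis, $\mathbb{R}^m_+=\{x:x_i\ge0\ \forall i\}$, $\mathbb{S}^{m-1}$ is the Euclidean unit sphere, $B_q^m=\{x\in\mathbb{R}^m:\sum_i|x_i|^q\le1\}$. $P_E$ is orthogonal projection onto $E$ and $|\cdot|_1$ is one-dimensional Lebesgue measure. With $h_K(u)=\sup_{k\in K}\langle k,u\rangle$, the face of $K$ in direction $u$ is $F(K;u):=\{k\in K:\langle k,u\rangle=h_K(u)\}$. *)

(* Defs.v *)
From HB Require Import structures.
From mathcomp Require Import all_boot all_order all_algebra.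
From mathcomp Require Import all_classical all_reals all_analysis.
Set Implicit Arguments.
Unset Strict Implicit.
Unset Printing Implicit Defensive.
Import Order.TTheory GRing.Theory Num.Theory.
Import numFieldNormedType.Exports.
Local Open Scope classical_set_scope.
Local Open Scope ring_scope.

Definition dotp (R : realType) (m : nat) (x y : 'rV[R]_m) : R :=
  \sum_(i < m) x 0 i * y 0 i.

(* The library norm on 'rV[R]_m is the sup norm, so the Euclidean one is needed
   for the sphere. *)
Definition enorm (R : realType) (m : nat) (x : 'rV[R]_m) : R :=
  Num.sqrt (dotp x x).

Definition usphere (R : realType) (m : nat) : set 'rV[R]_m :=
  [set v : 'rV[R]_m | enorm v = 1].
Arguments usphere {R m}.

Definition convex_body (R : realType) (m : nat) (K : set 'rV[R]_m) : Prop :=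
  [/\ compact K, convex_set K & K° !=set0].

Definition unconditional (R : realType) (m : nat) (K : set 'rV[R]_m) : Prop :=
  forall x eps : 'rV[R]_m, K x -> (forall i, eps 0 i = 1 \/ eps 0 i = -1) ->
    K (\row_i (eps 0 i * x 0 i)).

Definition orthant (R : realType) (m : nat) : set 'rV[R]_m :=
  [set x : 'rV[R]_m | forall i, 0 <= x 0 i].
Arguments orthant {R m}.

Definition neg_orthant (R : realType) (m : nat) : set 'rV[R]_m :=
  [set - x | x in orthant].
Arguments neg_orthant {R m}.

Definition lq_ball (R : realType) (m : nat) (q : R) : set 'rV[R]_m :=
  [set x : 'rV[R]_m | \sum_(i < m) `|x 0 i| `^ q <= 1].
Arguments lq_ball {R} m q.

(* The point of E at which x - y is orthogonal to E; it exists and is unique,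
   so the default value 0 of xget is never used. *)
Definition oproj (R : realType) (m : nat) (E : {vspace 'rV[R]_m})
    (x : 'rV[R]_m) : 'rV[R]_m :=
  xget 0 [set y | y \in E /\ forall z, z \in E -> dotp (x - y) z = 0].

(* One-dimensional Lebesgue measure on span(v), for v a unit vector: the map
   t |-> t *: v is then an isometry of R onto span(v), along which Lebesgue
   measure is transported. *)
Definition line_measure (R : realType) (m : nat) (v : 'rV[R]_m)
    (A : set 'rV[R]_m) : \bar R :=
  lebesgue_measure [set t : R | A (t *: v)].

Definition support_fun (R : realType) (m : nat) (K : set 'rV[R]_m)
    (u : 'rV[R]_m) : R :=
  sup [set dotp k u | k in K].

Definition face (R : realType) (m : nat) (K : set 'rV[R]_m)
    (u : 'rV[R]_m) : set 'rV[R]_m :=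
  [set k | K k /\ dotp k u = support_fun K u].

(* delta_mx 0 i is the canonical basis vector e_i; neg_part keeps the signs,
   i.e. v = pos_part v + neg_part v. *)
Definition pos_part (R : realType) (m : nat) (v : 'rV[R]_m) : 'rV[R]_m :=
  \sum_(i < m | 0 < v 0 i) v 0 i *: delta_mx 0 i.

Definition neg_part (R : realType) (m : nat) (v : 'rV[R]_m) : 'rV[R]_m :=
  \sum_(i < m | v 0 i < 0) v 0 i *: delta_mx 0 i.

(* Main.v *)
Require Import Defs.
From HB Require Import structures.
From mathcomp Require Import all_boot all_order all_algebra.
From mathcomp Require Import all_classical all_reals all_analysis.
From mathcomp Require Import lra.
Import Order.TTheory GRing.Theory Num.Theory.
Import numFieldNormedType.Exports.
Set Implicit Arguments.
Unset Strict Implicit.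
Unset Printing Implicit Defensive.
Local Open Scope classical_set_scope.
Local Open Scope ring_scope.

(** Write h for the support function of K. The projection of a compact convex
    set C onto the line spanned by a unit vector v is a segment of length
    h_C(v) + h_C(-v) ([line_measure_oproj]), so everything reduces to
    computing support functions.

    For unconditional K the projection of K has length 2 h(v), since K = -K.
    On the positive orthant, the best way to maximize <k, v> is to put nothing
    on the coordinates where v is nonpositive; since K is stable under absolute
    values and under erasing coordinates, the maximum over the orthant part of
    K is h(v_+) ([support_fun_orthant]). Applied to v and to -v, this shows
    that the projection of the orthant part has length h(v_+) + h(v_-).

    The two inequalities are then h(v_+) <= h(v), h(v_-) <= h(v), and
    h(v) <= h(v_+) + h(v_-). The last one is an equality exactly when a point
    of K maximizes both v_+ and v_- ([support_funD_eq]). When v or -v is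
    nonnegative, one of v_+, v_- vanishes and this always happens.

    For the l_q ball it happens in no other case: a maximizer of u <> 0
    restricted to the support of u is again a maximizer, hence lies on the
    boundary, so the coordinates in the support of u alone already have q-mass
    at least 1 ([face_lq_ball]). A common maximizer of v_+ and v_-, whose
    supports are disjoint, would have q-mass at least 2.

    For the sharpness of the left inequality, K is the l_1 ball and
    v = (e_i - e_j) / sqrt 2: then h(v_+), h(v_-) and h(v) are all equal to
    1 / sqrt 2. *)

(** * Dot product and projection onto a line *)

Section dot_product.
Variables (R : realType) (m : nat).
Implicit Types (x y u v : 'rV[R]_m) (a : R).

Lemma dotpC x y : dotp x y = dotp y x.
Proof. by apply: eq_bigr => i _; rewrite mulrC. Qed.

Lemma dotpDl x y u : dotp (x + y) u = dotp x u + dotp y u.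
Proof. by rewrite -big_split; apply: eq_bigr => i _; rewrite mxE mulrDl. Qed.

Lemma dotpZl a x u : dotp (a *: x) u = a * dotp x u.
Proof. by rewrite /dotp big_distrr; apply: eq_bigr => i _; rewrite mxE /= mulrA. Qed.

Lemma dotpNl x u : dotp (- x) u = - dotp x u.
Proof. by rewrite -scaleN1r dotpZl mulN1r. Qed.

Lemma dotpDr u x y : dotp u (x + y) = dotp u x + dotp u y.
Proof. by rewrite !(dotpC u) dotpDl. Qed.

Lemma dotpZr a u x : dotp u (a *: x) = a * dotp u x.
Proof. by rewrite !(dotpC u) dotpZl. Qed.

Lemma dotpNr u x : dotp u (- x) = - dotp u x.
Proof. by rewrite !(dotpC u) dotpNl. Qed.

Lemma dotp_delta i u : dotp (delta_mx 0 i) u = u 0 i.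
Proof.
rewrite /dotp (bigD1 i) //= big1 => [|j /negbTE ji]; last first.
  by rewrite mxE eqxx ji mul0r.
by rewrite mxE !eqxx mul1r addr0.
Qed.

Lemma dotp_gt0 u : u != 0 -> 0 < dotp u u.
Proof.
move=> u0; rewrite lt_neqAle sumr_ge0 => [|i _]; last by rewrite -expr2 sqr_ge0.
rewrite andbT eq_sym; apply: contra_neq u0 => /eqP.
rewrite psumr_eq0 => [/allP uu0|i _]; last by rewrite -expr2 sqr_ge0.
by apply/rowP => i; have := uu0 i (mem_index_enum _); rewrite mulf_eq0 orbb mxE => /eqP.
Qed.

Lemma usphere_dotp v : usphere v -> dotp v v = 1.
Proof.
rewrite /usphere/= /enorm => v1.
by rewrite -[LHS]sqr_sqrtr ?v1 ?expr1n// sumr_ge0// => i _; rewrite -expr2 sqr_ge0.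
Qed.

Lemma dotp_continuous u : continuous (fun x => dotp x u).
Proof.
move=> x; apply: (@cvg_big _ _ _ _ _ (@add_continuous _) _ (nbhs x) _
  (fun i y => y 0 i * u 0 i)) => i _.
by apply: cvgMl; exact: coord_continuous.
Qed.

Lemma oproj_line v x : usphere v -> oproj <[v]>%VS x = dotp x v *: v.
Proof.
move=> /usphere_dotp vv1; apply: xget_unique => [|y [/vlineP[a ->]]].
  split=> [|_ /vlineP[b ->]]; first by apply/vlineP; exists (dotp x v).
  by rewrite dotpZr dotpDl dotpNl dotpZl vv1 mulr1 subrr mulr0.
move=> /(_ v (memv_line v)).
by rewrite dotpDl dotpNl dotpZl vv1 mulr1 => /eqP; rewrite subr_eq0 => /eqP ->.
Qed.

End dot_product.

(** * Positive and negative parts of a vector *)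

Section parts.
Variables (R : realType) (m : nat).
Implicit Types v : 'rV[R]_m.

Lemma pos_partE v i : pos_part v 0 i = if 0 < v 0 i then v 0 i else 0.
Proof.
rewrite /pos_part summxE big_mkcond (bigD1 i) //= big1 => [|j ji].
  by rewrite addr0; case: ifP => // _; rewrite !mxE !eqxx mulr1.
by case: ifP => // _; rewrite !mxE eq_sym (negbTE ji) andbF mulr0.
Qed.

Lemma pos_partN v : pos_part (- v) = - neg_part v.
Proof.
rewrite /pos_part /neg_part -sumrN; apply: eq_big => [i|i _].
  by rewrite mxE oppr_gt0.
by rewrite mxE scaleNr.
Qed.

Lemma neg_partE v i : neg_part v 0 i = if v 0 i < 0 then v 0 i else 0.
Proof.
have -> : neg_part v = - pos_part (- v) by rewrite pos_partN opprK.
by rewrite mxE pos_partE mxE oppr_gt0; case: ifP; rewrite ?opprK ?oppr0.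
Qed.

Lemma pos_neg_part v : pos_part v + neg_part v = v.
Proof.
apply/rowP => i; rewrite mxE pos_partE neg_partE.
by case: ltrgt0P; rewrite ?addr0 ?add0r.
Qed.

Lemma neg_part_eq0 v : neg_part v = 0 <-> orthant v.
Proof.
split=> [v0 i|v0].
  have := neg_partE v i; rewrite v0 mxE.
  by case: ltrP => // vi0 vi; rewrite -vi ltxx in vi0.
by apply/rowP => i; rewrite neg_partE mxE ltNge v0.
Qed.

Lemma pos_part_eq0 v : pos_part v = 0 <-> neg_orthant v.
Proof.
rewrite -{1}[v]opprK pos_partN; split.
  by move=> /eqP; rewrite oppr_eq0 => /eqP/neg_part_eq0 ?; exists (- v); rewrite ?opprK.
by move=> [w w0 <-]; rewrite opprK (neg_part_eq0 w).2// oppr0.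
Qed.

End parts.

(** * Support functions and lengths of projections *)

Section support.
Variables (R : realType) (m : nat).
Implicit Types (K C : set 'rV[R]_m) (u v k : 'rV[R]_m).

Lemma support_fun_ub K u k : compact K -> K k -> dotp k u <= support_fun K u.
Proof.
move=> cK Kk; apply: sup_upper_bound; last by exists k.
apply: compact_has_sup; first by exists (dotp k u), k.
apply: continuous_compact => //.
exact/continuous_subspaceT/dotp_continuous.
Qed.

Lemma support_fun_attained K u : compact K -> K !=set0 -> face K u !=set0.
Proof.
move=> cK K0.
have [|k] := EVT_max_rV (f := fun k => dotp k u) K0 cK.
  exact/continuous_subspaceT/dotp_continuous.
rewrite inE => Kk kmax; exists k; split=> //.
apply/eqP; rewrite eq_le support_fun_ub//= ge_sup//.
  by exists (dotp k u), k.
by move=> _ [x Kx <-]; apply: kmax; rewrite inE.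
Qed.

(** The common form of all the comparisons below: [support_funN] changes the
    direction only, [support_fun_pos_part] the body only, and
    [support_fun_orthant] both. *)
Lemma support_fun_le K C u v : compact K -> K !=set0 -> compact C ->
  (forall k, K k -> exists2 l, C l & dotp k u <= dotp l v) ->
  support_fun K u <= support_fun C v.
Proof.
move=> cK K0 cC KC; have [k [Kk <-]] := support_fun_attained u cK K0.
by have [l Cl /le_trans] := KC k Kk; apply; exact: support_fun_ub.
Qed.

(** Convexity with a real coefficient instead of a bundled element of
    [{i01 R}]. *)
Lemma convex_setP C : convex_set C <->
  forall k l (t : R), C k -> C l -> 0 <= t -> t <= 1 ->
    C (t *: k + (1 - t) *: l).
Proof.
split=> [cC k l t Ck Cl t0 t1|cC k l t].
  by have := cC k l (Itv01 t0 t1); rewrite !inE; exact.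
by rewrite !inE => Ck Cl; apply: cC.
Qed.

(** In the coordinate t of t *: v the projection is the image of C under
    <., v>; by compactness the extreme values are attained, and by convexity
    the segment between two maximizers of v and -v covers what lies between. *)
Lemma line_measure_oproj C v : compact C -> convex_set C -> C !=set0 ->
  usphere v ->
  line_measure v (oproj <[v]>%VS @` C)
    = (support_fun C v + support_fun C (- v))%:E.
Proof.
move=> cC convC C0 sv.
have vv1 := usphere_dotp sv.
have [k [Ck hk]] := support_fun_attained v cC C0.
have [l [Cl hl]] := support_fun_attained (- v) cC C0.
have le_lk : - support_fun C (- v) <= support_fun C v.
  by rewrite -hl dotpNr opprK support_fun_ub.
rewrite /line_measure.
suff -> : [set t | (oproj <[v]>%VS @` C) (t *: v)] =
    `[- support_fun C (- v), support_fun C v]%classic.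
  rewrite lebesgue_measure_itv/= lte_fin -EFinD opprK.
  case: ltP => // ge_lk; congr _%:E.
  by apply/esym; rewrite -[X in _ + X]opprK; apply/eqP; rewrite subr_eq0 eq_le ge_lk.
apply/seteqP; split=> t /=; rewrite in_itv/=.
  move=> [x Cx]; rewrite oproj_line// => /(congr1 (dotp v)).
  rewrite !dotpZr vv1 !mulr1 => <-.
  by rewrite lerNl -dotpNr !support_fun_ub.
move=> /andP[lt tk].
suff [x Cx xt] : exists2 x, C x & dotp x v = t.
  by exists x => //; rewrite oproj_line// xt.
rewrite -hl -hk dotpNr opprK in lt tk le_lk.
have [kl|lk] := eqVneq (dotp l v) (dotp k v).
  by exists l => //; apply/eqP; rewrite eq_le lt kl tk.
have kl0 : 0 < dotp k v - dotp l v by rewrite subr_gt0 lt_neqAle lk.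
(* the barycentric coordinate of t between the two extreme values *)
pose s := (t - dotp l v) / (dotp k v - dotp l v).
exists (s *: k + (1 - s) *: l).
  apply: (convex_setP C).1 => //; rewrite /s.
    by rewrite divr_ge0 ?(ltW kl0)// subr_ge0.
  by rewrite ler_pdivrMr// mul1r lerB.
rewrite dotpDl !dotpZl mulrBl mul1r addrCA -mulrBr divfK ?gt_eqF// addrC.
by rewrite subrK.
Qed.

(** From an interior point one can still move a little in the direction u,
    which increases <., u>. *)
Lemma face_interior K u k : compact K -> u != 0 -> face K u k -> ~ K° k.
Proof.
move=> cK u0 [_ ku] Kk.
have kcvg : k + d *: u @[d --> (0 : R)^'+] --> k.
  rewrite -{2}[k]addr0 -(scale0r u).
  apply: cvgD; first exact: cvg_cst.
  by apply: cvgZl; exact: cvg_at_right_filter.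
have /= Kd : \forall d \near (0 : R)^'+, K (k + d *: u) := kcvg _ Kk.
have [d] : exists d : R, 0 < d /\ K (k + d *: u).
  near (0 : R)^'+ => d; exists d; split; near: d => //.
  exact: nbhs_right_gt.
move=> [d0 /(support_fun_ub u cK)].
by rewrite dotpDl dotpZl ku gerDl leNgt mulr_gt0// dotp_gt0.
Unshelve. all: by end_near. Qed.

End support.

(** * Unconditional convex sets *)

Section unconditional_sets.
Variables (R : realType) (m : nat).
Implicit Types (K : set 'rV[R]_m) (u v k : 'rV[R]_m).

Lemma unconditionalN K k : unconditional K -> K k -> K (- k).
Proof.
move=> uK Kk; have := uK k (const_mx (- 1)) Kk.
under eq_mx do rewrite mxE mulN1r -[- _]/(- _ : R).
suff -> : \row_i - k 0 i = - k by apply=> i; right; rewrite mxE.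
by apply/rowP => i; rewrite !mxE.
Qed.

Lemma unconditional_abs K k : unconditional K -> K k -> K (\row_i `|k 0 i|).
Proof.
move=> uK Kk; have := uK k (\row_i (if 0 <= k 0 i then 1 else - 1)) Kk.
suff -> : \row_i ((\row_i (if 0 <= k 0 i then 1 else - 1)) 0 i * k 0 i) =
          \row_i `|k 0 i|.
  by apply=> i; rewrite mxE; case: ifP; [left|right].
by apply/rowP => i; rewrite !mxE; case: ger0P; rewrite ?mul1r ?mulN1r.
Qed.

(** Erasing coordinates is averaging a point with its reflection in those
    coordinates. *)
Lemma unconditional_restrict K (P : pred 'I_m) k :
  convex_set K -> unconditional K -> K k ->
  K (\row_i (if P i then k 0 i else 0)).
Proof.
move=> cK uK Kk.
pose s : 'rV[R]_m := \row_i (if P i then 1 else - 1).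
have Ks : K (\row_i (s 0 i * k 0 i)).
  by apply: uK => // i; rewrite mxE; case: ifP; [left|right].
have := (convex_setP K).1 cK _ _ 2^-1 Kk Ks.
rewrite invr_ge0 ler0n invf_le1 ?ltr0n// ler1n => /(_ isT isT).
congr (K _); apply/rowP => i; rewrite !mxE.
by case: ifP => _; lra.
Qed.

Lemma closed_orthant : closed (@orthant R m).
Proof.
have -> : @orthant R m = \bigcap_i [set x : 'rV[R]_m | 0 <= x 0 i].
  by apply/seteqP; split=> [x x0 i _|x x0 i]; exact: x0.
apply: closed_bigI => i _.
apply: (preimage_closed _ (@closed_ge _ _)) => x _.
exact: coord_continuous.
Qed.

Lemma convex_orthant : convex_set (@orthant R m).
Proof.
apply/convex_setP => x y t x0 y0 t0 t1 i; rewrite !mxE.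
by rewrite addr_ge0// mulr_ge0// subr_ge0.
Qed.

Lemma support_funN K u : compact K -> unconditional K -> K !=set0 ->
  support_fun K (- u) = support_fun K u.
Proof.
move=> cK uK K0.
apply/eqP; rewrite eq_le; apply/andP; split; apply: support_fun_le => // k;
  by move=> /(unconditionalN uK) Kk; exists (- k); rewrite // dotpNl dotpNr ?opprK.
Qed.

(** A point of K becomes a nonnegative one that does at least as well for v
    as the original one did for v_+ by taking absolute values and erasing the
    coordinates where v is nonpositive. Conversely v <= v_+ coordinatewise, so
    nonnegative points do at least as well for v_+ as for v. *)
Lemma support_fun_orthant K v :
  compact K -> convex_set K -> unconditional K -> K !=set0 ->
  support_fun (K `&` orthant) v = support_fun K (pos_part v).
Proof.
move=> cK convK uK K0.
have cK1 : compact (K `&` orthant) by exact: compact_closedI cK closed_orthant.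
have K1 k : K k -> (K `&` orthant) (\row_i (if 0 < v 0 i then `|k 0 i| else 0)).
  move=> Kk; split=> [|i]; last by rewrite mxE; case: ifP.
  have := unconditional_restrict (fun i => 0 < v 0 i) convK uK
            (unconditional_abs uK Kk).
  by congr (K _); apply/rowP => i; rewrite !mxE.
apply/eqP; rewrite eq_le; apply/andP; split; apply: support_fun_le => //.
- by have [k /K1 Kk] := K0; eexists; exact: Kk.
- move=> k [Kk k0]; exists k => //; apply: ler_sum => i _.
  by rewrite pos_partE; case: ltrP => // vi; rewrite mulr0 mulr_ge0_le0.
- move=> k /K1 Kk; exists (\row_i (if 0 < v 0 i then `|k 0 i| else 0)) => //.
  apply: ler_sum => i _; rewrite pos_partE mxE; case: ifP => vi.
    by rewrite ler_pM2r// ler_norm.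
  by rewrite mulr0 mul0r.
Qed.

Lemma line_measure_oproj_orthant K v :
  compact K -> convex_set K -> unconditional K -> K !=set0 -> usphere v ->
  line_measure v (oproj <[v]>%VS @` (K `&` orthant))
    = (support_fun K (pos_part v) + support_fun K (neg_part v))%:E.
Proof.
move=> cK convK uK K0 sv.
rewrite line_measure_oproj//.
- by rewrite !support_fun_orthant// pos_partN support_funN.
- exact: compact_closedI cK closed_orthant.
- apply/convex_setP => x y t [Kx x0] [Ky y0] t0 t1.
  by split; [exact: (convex_setP K).1|exact: (convex_setP orthant).1 convex_orthant _ _ _ _ _ _ _].
- have [k Kk] := K0; exists (\row_i `|k 0 i|); split=> [|i]; last by rewrite mxE.
  exact: unconditional_abs.
Qed.

Lemma line_measure_oproj_unconditional K v :
  compact K -> convex_set K -> unconditional K -> K !=set0 -> usphere v ->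
  line_measure v (oproj <[v]>%VS @` K) = (2 * support_fun K v)%:E.
Proof.
by move=> *; rewrite line_measure_oproj// support_funN// mulr_natl mulr2n.
Qed.

Lemma support_funD K u v : compact K -> K !=set0 ->
  support_fun K (u + v) <= support_fun K u + support_fun K v.
Proof.
move=> cK K0; have [k [Kk <-]] := support_fun_attained (u + v) cK K0.
by rewrite dotpDr lerD// support_fun_ub.
Qed.

(** A maximizer of u + v gives to u and to v at most their maxima, so the sum of
    the maxima is reached only if both are. *)
Lemma support_funD_eq K u v : compact K -> K !=set0 ->
  support_fun K (u + v) = support_fun K u + support_fun K v <->
  face K u `&` face K v !=set0.
Proof.
move=> cK K0; split.
  have [k [Kk <-]] := support_fun_attained (u + v) cK K0.
  have ku := support_fun_ub u cK Kk; have kv := support_fun_ub v cK Kk.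
  by rewrite dotpDr => kuv; exists k; do 2!split=> //; lra.
move=> [k [[Kk ku] [_ kv]]]; apply/eqP; rewrite eq_le support_funD//=.
by rewrite -{1}ku -kv -dotpDr support_fun_ub.
Qed.

End unconditional_sets.

(** * The balls of the l_q norms *)

Section lq_balls.
Variables (R : realType) (m : nat) (q : R).
Hypothesis q1 : 1 <= q.
Implicit Types (u v k x : 'rV[R]_m).

Let q_gt0 : 0 < q. Proof. exact: lt_le_trans q1. Qed.

(** Away from 0 the power is differentiable; at 0, the bound e on |t|^q is
    guaranteed by |t| < e^(1/q). *)
Lemma continuous_norm_powR : continuous (fun t : R => `|t| `^ q).
Proof.
move=> t; have [->|t0] := eqVneq t 0.
  rewrite /continuous_at normr0 powR0 ?gt_eqF//.
  apply/cvgrPdist_lt => e e0; near=> s.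
  rewrite sub0r normrN ger0_norm ?powR_ge0//.
  have se : `|s| < e `^ q^-1.
    by near: s; apply: (@pseudometric_normed_Zmodule.nbhs0_lt _ R^o); exact: powR_gt0.
  rewrite -[ltRHS]powRr1 ?ltW// -(mulVf (lt0r_neq0 q_gt0)) powRrM.
  by rewrite gt0_ltr_powR ?nnegrE ?powR_ge0.
apply: (@continuous_comp _ _ _ (fun s : R => `|s|) (fun s => s `^ q)).
  exact: norm_continuous.
apply/differentiable_continuous/derivable1_diffP/derivable_powR.
by rewrite in_itv/= andbT normr_gt0.
Unshelve. all: by end_near. Qed.

Lemma continuous_lq_sum :
  continuous (fun x : 'rV[R]_m => \sum_(i < m) `|x 0 i| `^ q).
Proof.
move=> x.
apply: (@cvg_big _ _ _ _ _ (@add_continuous _) _ (nbhs x) _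
  (fun i y => `|y 0 i| `^ q)) => i _.
apply: (@continuous_comp _ _ _ (fun y : 'rV[R]_m => y 0 i)
  (fun t : R => `|t| `^ q)).
  exact: coord_continuous.
exact: continuous_norm_powR.
Qed.

Lemma convex_lq_ball : convex_set (@lq_ball R m q).
Proof.
apply/convex_setP => x y t; rewrite /lq_ball/= => x1 y1 t0 t1.
have t1' : 0 <= 1 - t by rewrite subr_ge0.
have /le_trans -> // : \sum_(i < m) `|(t *: x + (1 - t) *: y) 0 i| `^ q <=
    t * (\sum_(i < m) `|x 0 i| `^ q) + (1 - t) * (\sum_(i < m) `|y 0 i| `^ q).
  rewrite !mulr_sumr -big_split/=; apply: ler_sum => i _; rewrite !mxE.
  apply: (@le_trans _ _ ((t * `|x 0 i| + (1 - t) * `|y 0 i|) `^ q)).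
    rewrite ge0_ler_powR ?(ltW q_gt0) ?nnegrE//.
      by rewrite addr_ge0// mulr_ge0.
    by rewrite (le_trans (ler_normD _ _))// !normrM (ger0_norm t0) (ger0_norm t1').
  by apply: (convex_powR q1 (Itv01 t0 t1)) => //=;
    rewrite inE/= in_itv/= andbT.
by have := ler_wpM2l t0 x1; have := ler_wpM2l t1' y1; lra.
Qed.

(** As q >= 1, a coordinate larger than 1 has a q-th power larger than 1, so the
    ball is a closed subset of a cube. *)
Lemma compact_lq_ball : compact (@lq_ball R m q).
Proof.
apply: (@subclosed_compact _ _
  [set x : 'rV[R]_m | forall i, `[-1 : R, 1]%classic (x ord0 i)]).
- apply: (preimage_closed _ (@closed_le _ 1)) => x _.
  exact: continuous_lq_sum.
- apply: (@rV_compact R m (fun=> `[-1 : R, 1]%classic)) => _.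
  exact: segment_compact.
move=> x; rewrite /lq_ball/= => x1 i; rewrite in_itv/= -ler_norml leNgt.
apply/negP => xi; move: x1; apply/negP; rewrite -ltNge.
apply: lt_le_trans (_ : `|x 0 i| `^ q <= _).
  by apply: (lt_le_trans xi); rewrite le1r_powR// ltW.
by rewrite (bigD1 i)//= lerDl sumr_ge0// => j _; exact: powR_ge0.
Qed.

Lemma unconditional_lq_ball : unconditional (@lq_ball R m q).
Proof.
move=> x s; rewrite /lq_ball/= => x1 s1; rewrite (le_trans _ x1)//.
apply: ler_sum => i _; rewrite mxE normrM.
by have [->|->] := s1 i; rewrite ?normrN normr1 mul1r.
Qed.

Lemma interior_lq_ball x :
  \sum_(i < m) `|x 0 i| `^ q < 1 -> (@lq_ball R m q)° x.
Proof.
by move=> x1; exact: cvgr_le (@continuous_lq_sum x) _ x1.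
Qed.

Lemma lq_ball_nonempty_interior : (@lq_ball R m q)° 0.
Proof.
apply: interior_lq_ball; rewrite big1// => i _.
by rewrite mxE normr0 powR0// gt_eqF.
Qed.

Lemma convex_body_lq_ball : convex_body (@lq_ball R m q).
Proof.
split; [exact: compact_lq_ball|exact: convex_lq_ball|].
by exists 0; exact: lq_ball_nonempty_interior.
Qed.

(** Erasing the coordinates outside the support of u keeps k in the face; if the
    remaining q-mass were less than 1, the new point would be interior. *)
Lemma face_lq_ball u k : u != 0 -> face (lq_ball m q) u k ->
  1 <= \sum_(i < m | u 0 i != 0) `|k 0 i| `^ q.
Proof.
move=> u0 [k1 ku]; rewrite leNgt; apply/negP => kS.
pose k' : 'rV[R]_m := \row_i (if u 0 i != 0 then k 0 i else 0).
have k'E : \sum_(i < m) `|k' 0 i| `^ q = \sum_(i < m | u 0 i != 0) `|k 0 i| `^ q.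
  rewrite [RHS]big_mkcond; apply: eq_bigr => i _; rewrite mxE.
  by case: ifP => // _; rewrite normr0 powR0// gt_eqF.
apply: (@face_interior _ _ _ u k' compact_lq_ball u0); last first.
  by apply: interior_lq_ball; rewrite k'E.
split; first by rewrite /lq_ball/= k'E ltW.
rewrite -ku; apply: eq_bigr => i _; rewrite mxE.
by case: eqVneq => //= ->; rewrite !mulr0.
Qed.

(** A common point would carry q-mass at least 1 on each of the two disjoint
    supports. *)
Lemma faces_lq_ball_disjoint u v : u != 0 -> v != 0 ->
  (forall i, u 0 i = 0 \/ v 0 i = 0) ->
  face (lq_ball m q) u `&` face (lq_ball m q) v = set0.
Proof.
move=> u0 v0 uv; rewrite -subset0 => k [ku kv].
have := face_lq_ball u0 ku; have := face_lq_ball v0 kv.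
have [/= k1 _] := ku.
suff : \sum_(i < m | u 0 i != 0) `|k 0 i| `^ q +
       \sum_(i < m | v 0 i != 0) `|k 0 i| `^ q <= \sum_(i < m) `|k 0 i| `^ q.
  by rewrite /lq_ball/= in k1; lra.
rewrite big_mkcond [X in _ + X]big_mkcond -big_split/=; apply: ler_sum => i _.
by have [->|->] := uv i; rewrite eqxx/=; case: ifP => _;
  rewrite ?add0r ?addr0 ?powR_ge0.
Qed.

End lq_balls.

(** * Comparison of the two lengths *)

Section parts_comparison.
Variables (R : realType) (m : nat) (K : set 'rV[R]_m).
Hypotheses (cK : compact K) (convK : convex_set K) (uK : unconditional K).
Hypothesis K0 : K !=set0.
Implicit Types v : 'rV[R]_m.

(** The orthant part of K is contained in K, and its support function at v is
    that of K at v_+. *)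
Lemma support_fun_pos_part v : support_fun K (pos_part v) <= support_fun K v.
Proof.
rewrite -support_fun_orthant//.
apply: support_fun_le => //.
- exact: compact_closedI cK (@closed_orthant R m).
- have [k Kk] := K0; exists (\row_i `|k 0 i|); split=> [|i]; last by rewrite mxE.
  exact: unconditional_abs.
- by move=> k [Kk _]; exists k.
Qed.

Lemma support_fun_neg_part v : support_fun K (neg_part v) <= support_fun K v.
Proof.
rewrite -(support_funN (neg_part v))// -pos_partN -(support_funN v)//.
exact: support_fun_pos_part.
Qed.

Lemma line_measure_double v : usphere v ->
  line_measure v (oproj <[v]>%VS @` K)
    = (2%:E * line_measure v (oproj <[v]>%VS @` (K `&` orthant)))%E
  <-> face K (pos_part v) `&` face K (neg_part v) !=set0.
Proof.
move=> sv; rewrite line_measure_oproj_unconditional// line_measure_oproj_orthant// -EFinM.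
rewrite -support_funD_eq// pos_neg_part; split=> [[]|->//].
by apply: mulfI; rewrite pnatr_eq0.
Qed.

Lemma faces_parts_meet v : (orthant `|` neg_orthant) v ->
  face K (pos_part v) `&` face K (neg_part v) !=set0.
Proof.
move=> vS; apply/support_funD_eq => //; rewrite pos_neg_part.
have h0 : support_fun K 0 = 0.
  have [k [_ <-]] := support_fun_attained 0 cK K0.
  by rewrite -(scale0r 0) dotpZr mul0r.
rewrite -{1}[v]pos_neg_part.
by case: vS => [/neg_part_eq0|/pos_part_eq0] ->; rewrite h0 ?addr0 ?add0r.
Qed.

End parts_comparison.

(** The maximum of (k_i - k_j) / sqrt 2 over the l_1 ball is 1 / sqrt 2, and it
    is reached both at e_i, where only v_+ contributes, and at - e_j, where only
    v_- contributes. *)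
Lemma l1_ball_support_fun_parts (R : realType) (m : nat) (i j : 'I_m) : i != j ->
  exists v : 'rV[R]_m, usphere v /\
    (support_fun (lq_ball m 1) v <= support_fun (lq_ball m 1) (pos_part v) /\
     support_fun (lq_ball m 1) v <= support_fun (lq_ball m 1) (neg_part v)).
Proof.
move=> ij; pose c : R := (Num.sqrt 2)^-1.
have c0 : 0 < c by rewrite invr_gt0 sqrtr_gt0 ltr0n.
pose v : 'rV[R]_m := c *: (delta_mx 0 i - delta_mx 0 j).
have dotpv k : dotp k v = c * (k 0 i - k 0 j).
  by rewrite dotpC dotpZl dotpDl dotpNl !dotp_delta.
have vi : v 0 i = c by rewrite !mxE !eqxx (negbTE ij) subr0 mulr1.
have vj : v 0 j = - c.
  by rewrite !mxE !eqxx eq_sym (negbTE ij) sub0r mulrN1.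
have ballc k : lq_ball m 1 k -> dotp k v <= c.
  rewrite /lq_ball/= (bigD1 i)//= (bigD1 j) 1?eq_sym//= !powRr1// => k1.
  have sum0 : 0 <= \sum_(l < m | (l != i) && (l != j)) `|k 0 l| `^ 1.
    by apply: sumr_ge0 => l _; exact: powR_ge0.
  rewrite dotpv ler_piMr ?(ltW c0)//.
  by have := ler_norm (k 0 i); have := ler_norm (- k 0 j); rewrite normrN; lra.
have ballE (s : R) l : `|s| = 1 -> lq_ball m 1 (s *: delta_mx 0 l).
  move=> s1; rewrite /lq_ball/= (bigD1 l)//= big1 => [|n /negbTE nl].
    by rewrite !mxE !eqxx mulr1 s1 powR1 addr0.
  by rewrite !mxE eqxx nl mulr0 normr0 powR0 ?oner_neq0.
have cB := @compact_lq_ball R m 1 (lexx 1).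
have B0 : lq_ball m (1 : R) !=set0.
  by exists (1 *: delta_mx 0 i); apply: ballE; rewrite normr1.
exists v; split; first last.
  split; apply: support_fun_le => // k /ballc kc.
    exists (1 *: delta_mx 0 i); first by apply: ballE; rewrite normr1.
    by rewrite dotpZl mul1r dotp_delta pos_partE vi c0.
  exists (-1 *: delta_mx 0 j); first by apply: ballE; rewrite normrN1.
  by rewrite dotpZl mulN1r dotp_delta neg_partE vj oppr_lt0 c0 opprK.
rewrite /usphere/= /enorm dotpv vi vj opprK -mulr2n mulrnAr -expr2.
by rewrite exprVn sqr_sqrtr ?ler0n// -mulr_natr mulVf ?pnatr_eq0// sqrtr1.
Qed.

Theorem proposition4 (R : realType) (m : nat) :
  (forall (K : set 'rV[R]_m) (v : 'rV[R]_m),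
     convex_body K -> unconditional K -> usphere v ->
     let E := <[v]>%VS in
     [/\ (line_measure v (oproj E @` (K `&` orthant))
            <= line_measure v (oproj E @` K))%E,
         (line_measure v (oproj E @` K)
            <= 2%:E * line_measure v (oproj E @` (K `&` orthant)))%E
       & (line_measure v (oproj E @` K)
            = 2%:E * line_measure v (oproj E @` (K `&` orthant)))%E
         <->
         ((orthant `|` neg_orthant) v \/
          (~ (orthant `|` neg_orthant) v /\
           face K (pos_part v) `&` face K (neg_part v) !=set0))])
  /\
  (forall (q : R) (v : 'rV[R]_m),
     1 <= q -> usphere v ->
     let E := <[v]>%VS in
     let K := lq_ball m q in
     (line_measure v (oproj E @` K)
        = 2%:E * line_measure v (oproj E @` (K `&` orthant)))%E
     <-> (orthant `|` neg_orthant) v)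
  /\
  ((2 <= m)%N ->
     exists (K : set 'rV[R]_m) (v : 'rV[R]_m),
       [/\ convex_body K, unconditional K, usphere v
         & let E := <[v]>%VS in
           line_measure v (oproj E @` (K `&` orthant))
             = line_measure v (oproj E @` K)]).
Proof.
split; last split.
- move=> K v [cK convK [k0 /interior_subset K0]] uK sv /=.
  have Kne : K !=set0 by exists k0.
  have hpos := support_fun_pos_part cK convK uK Kne v.
  have hneg := support_fun_neg_part cK convK uK Kne v.
  have hD := support_funD (pos_part v) (neg_part v) cK Kne.
  rewrite pos_neg_part in hD.
  split.
  + rewrite line_measure_oproj_orthant// line_measure_oproj_unconditional//.
    by rewrite lee_fin; lra.
  + rewrite line_measure_oproj_unconditional// line_measure_oproj_orthant//.
    by rewrite -EFinM lee_fin; lra.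
  + rewrite line_measure_double//; split=> [faces|[|[]//]].
      by have [|] := pselect ((orthant `|` neg_orthant) v); [left|right].
    exact: faces_parts_meet.
- move=> q v q1 sv /=.
  have cB := @compact_lq_ball R m q q1.
  have Bne : lq_ball m q !=set0.
    by exists 0; apply: interior_subset; exact: lq_ball_nonempty_interior.
  rewrite line_measure_double//; last 2 first.
  + exact: convex_lq_ball.
  + exact: unconditional_lq_ball.
  split=> [|vS]; last exact: faces_parts_meet.
  have [/neg_part_eq0|vn0] := eqVneq (neg_part v) 0; first by left.
  have [/pos_part_eq0|vp0] := eqVneq (pos_part v) 0; first by right.
  rewrite (faces_lq_ball_disjoint q1 vp0 vn0) => [[]//|i].
  by rewrite pos_partE neg_partE; case: ltrgt0P; [right|left|left].
- move=> m2; pose i := Ordinal (ltnW m2); pose j := Ordinal m2.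
  have [//|v [sv [hpos hneg]]] := @l1_ball_support_fun_parts R m i j.
  have bB := @convex_body_lq_ball R m 1 (lexx 1).
  have uB := @unconditional_lq_ball R m 1.
  exists (lq_ball m 1), v; split=> //=.
  have [cB convB [k0 /interior_subset B0]] := bB.
  have Bne : lq_ball m (1 : R) !=set0 by exists k0.
  have hpos' := support_fun_pos_part cB convB uB Bne v.
  have hneg' := support_fun_neg_part cB convB uB Bne v.
  rewrite line_measure_oproj_orthant// line_measure_oproj_unconditional//.
  by congr _%:E; lra.
Qed.
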